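(* Let $A$ be a finite-dimensional left-symmetric algebra over a field $\mathbb{F}$ of characteristic zero satisfying $(x\cdot y)\cdot z=(y\cdot x)\cdot z$ for all $x,y,z\in A$. Then $R(A)$ is a two-sided ideal of $A$ containing the derived Lie algebra $[A,A]$.
   Context: A left-symmetric algebra over $\mathbb{F}$ is a vector space $A$ over $\mathbb{F}$ with a bilinear product $\cdot$ such that $(x\cdot y)\cdot z-x\cdot(y\cdot z)=(y\cdot x)\cdot z-y\cdot(x\cdot z)$ for all $x,y,z\in A$. Put $[x,y]=x\cdot y-y\cdot x$; this is a Lie bracket and $[A,A]$ denotes the span of all $[x,y]$. Let $R_a:A\to A$, $R_a(x)=x\cdot a$. The (Koszul) radical $R(A)$ is the largest left ideal of $A$ contained in the subspace $I(A)=\{a\in A:\operatorname{tr}(R_a)=0\}$. *)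

(* Defs.v *)
From HB Require Import structures.
From mathcomp Require Import all_boot all_order all_algebra.

Set Implicit Arguments.
Unset Strict Implicit.
Unset Printing Implicit Defensive.

Import GRing.Theory passmx.
Local Open Scope ring_scope.

Definition left_symmetric (F : fieldType) (A : vectType F)
    (mul : {bilinear A -> A -> A}) : Prop :=
  forall x y z : A,
    mul (mul x y) z - mul x (mul y z) = mul (mul y x) z - mul y (mul x z).

Definition bracket (F : fieldType) (A : vectType F)
    (mul : {bilinear A -> A -> A}) (x y : A) : A := mul x y - mul y x.

(* By bilinearity, the brackets of basis vectors span the same subspace as all
   brackets (derived_lieP). *)
Definition derived_lie (F : fieldType) (A : vectType F)
    (mul : {bilinear A -> A -> A}) : {vspace A} :=
  <<[seq bracket mul x y | x <- vbasis {:A}, y <- vbasis {:A}]>>%VS.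

Definition lfun_trace (F : fieldType) (A : vectType F) (f : 'End(A)) : F :=
  \tr (mxof (vbasis {:A}) (vbasis {:A}) f).

(* R_a : x |-> mul x a (right_multE). *)
Definition right_mult (F : fieldType) (A : vectType F)
    (mul : {bilinear A -> A -> A}) (a : A) : 'End(A) :=
  linfun (applyr mul a).

Definition trace_right_mult (F : fieldType) (A : vectType F)
    (mul : {bilinear A -> A -> A}) (a : A) : F^o :=
  lfun_trace (right_mult mul a).

(* I(A) = {a | tr R_a = 0} (mem_trace_kernel). *)
Definition trace_kernel (F : fieldType) (A : vectType F)
    (mul : {bilinear A -> A -> A}) : {vspace A} :=
  lker (linfun (trace_right_mult mul)).

Definition left_ideal (F : fieldType) (A : vectType F)
    (mul : {bilinear A -> A -> A}) (L : {vspace A}) : Prop :=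
  forall x a : A, a \in L -> mul x a \in L.

Definition right_ideal (F : fieldType) (A : vectType F)
    (mul : {bilinear A -> A -> A}) (L : {vspace A}) : Prop :=
  forall a x : A, a \in L -> mul a x \in L.

Definition two_sided_ideal (F : fieldType) (A : vectType F)
    (mul : {bilinear A -> A -> A}) (L : {vspace A}) : Prop :=
  left_ideal mul L /\ right_ideal mul L.

Definition largest_left_ideal_in (F : fieldType) (A : vectType F)
    (mul : {bilinear A -> A -> A}) (V L : {vspace A}) : Prop :=
  [/\ left_ideal mul L, (L <= V)%VS &
      forall L' : {vspace A},
        left_ideal mul L' -> (L' <= V)%VS -> (L' <= L)%VS].

Section Facts.

Variables (F : fieldType) (A : vectType F) (mul : {bilinear A -> A -> A}).

Lemma right_multE (a x : A) : right_mult mul a x = mul x a.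
Proof. by rewrite lfunE. Qed.

Fact trace_right_mult_is_linear : linear (trace_right_mult mul).
Proof.
move=> k a b; rewrite /trace_right_mult /lfun_trace.
have ->: right_mult mul (k *: a + b) = k *: right_mult mul a + right_mult mul b.
  by apply/lfunP=> x; rewrite add_lfunE scale_lfunE !right_multE linearPr.
by rewrite linearP mxtraceD mxtraceZ.
Qed.

HB.instance Definition _ := GRing.isLinear.Build F A F^o *:%R
  (trace_right_mult mul) trace_right_mult_is_linear.

Lemma mem_trace_kernel (a : A) :
  (a \in trace_kernel mul) = (lfun_trace (right_mult mul a) == 0).
Proof. by rewrite memv_ker lfunE. Qed.

Lemma derived_lieP (U : {vspace A}) :
  (derived_lie mul <= U)%VS <-> (forall x y : A, bracket mul x y \in U).
Proof.
have bDl x : linear ((bracket mul)^~ x).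
  move=> k u v; rewrite /bracket linearPl linearPr /=.
  by rewrite scalerBr opprD addrACA.
have bDr x : linear (bracket mul x).
  move=> k u v; rewrite /bracket linearPl linearPr /=.
  by rewrite scalerBr opprD addrACA.
have span_in (f : A -> A) : linear f ->
    (forall x, x \in vbasis {:A} -> f x \in U) -> forall x, f x \in U.
  move=> lf hf x.
  pose h := GRing.isLinear.Build F A A *:%R f lf.
  pose g : {linear A -> A} := HB.pack f h.
  rewrite -[f x]/(g x) (coord_vbasis (memvf x)) linear_sum memv_suml // => i _.
  by rewrite linearZ memvZ // hf // mem_nth // size_tuple.
split=> [/span_subvP sU | hU].
  move=> x y; apply: (span_in _ (bDl y)) => {}x bx.
  apply: (span_in _ (bDr x)) => {}y b_y.
  by apply: sU; apply/allpairsP; exists (x, y).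
by apply/span_subvP=> _ /allpairsP[[x y] [_ _ ->]].
Qed.

Lemma largest_left_ideal_exists (V : {vspace A}) :
  {L : {vspace A} | largest_left_ideal_in mul V L}.
Proof.
have [n] := ubnP (\dim V); elim: n V => // n IHn V; rewrite ltnS => dimV.
pose b := vbasis {:A}.
pose W := (V :&: \bigcap_(i < \dim {:A}) (linfun (mul b`_i) @^-1: V))%VS.
have memW v : v \in W -> forall x, mul x v \in V.
  rewrite memv_cap memvE => /andP[_ /subv_bigcapP vW] x.
  rewrite -[mul x v]/(applyr mul v x) (coord_vbasis (memvf x)) linear_sum.
  rewrite memv_suml // => i _; rewrite linearZ memvZ //=.
  by have := vW i isT; rewrite -memvE -memv_preim lfunE.
have idealW L : left_ideal mul L -> (L <= V)%VS -> (L <= W)%VS.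
  move=> idL sLV; rewrite subv_cap sLV /=; apply/subv_bigcapP=> i _.
  apply/subvP=> v Lv; rewrite -memv_preim lfunE.
  by apply: (subvP sLV); apply: idL.
have sWV : (W <= V)%VS := capvSl _ _.
have [eqWV | neWV] := eqVneq W V.
  by exists V; split=> // x a; rewrite -{1}eqWV => /memW.
have ltW : (\dim W < n)%N.
  rewrite (leq_trans _ dimV) // ltnNge; apply: contra neWV => leVW.
  by rewrite eqEdim sWV.
have [L [idL sLW maxL]] := IHn W ltW.
exists L; split=> // [|L' idL' sL'V]; first exact: subv_trans sLW sWV.
by apply: maxL => //; apply: idealW.
Qed.

End Facts.

(* R(A), characterised by koszul_radicalP. *)
Definition koszul_radical (F : fieldType) (A : vectType F)
    (mul : {bilinear A -> A -> A}) : {vspace A} :=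
  sval (largest_left_ideal_exists mul (trace_kernel mul)).

Lemma koszul_radicalP (F : fieldType) (A : vectType F)
    (mul : {bilinear A -> A -> A}) :
  largest_left_ideal_in mul (trace_kernel mul) (koszul_radical mul).
Proof. exact: svalP (largest_left_ideal_exists mul (trace_kernel mul)). Qed.

(* Main.v *)
(* The hypothesis says that [x, y] z = 0, so every d in [A, A] annihilates A
   from the left. Hence (x d) d = (d x) d = 0, so R_d squares to zero and has
   trace zero; moreover x d = [x, d], so [A, A] is a left ideal contained in
   I(A), hence in R(A). Finally a x = x a + [a, x] gives the right ideal
   property. *)
Require Import Defs.
From HB Require Import structures.
From mathcomp Require Import all_boot all_order all_algebra.
Import GRing.Theory passmx.
Local Open Scope ring_scope.

Lemma mxtrace_sqr0 (F : fieldType) (n : nat) (M : 'M[F]_n) :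
  M *m M = 0 -> \tr M = 0.
Proof.
(* Full-rank factorization: M = C R and C (R C) R = 0 force R C = 0. *)
rewrite -{3}(mulmx_base M) mxtrace_mulC -{1 2}(mulmx_base M) => MM0.
suff ->: row_base M *m col_base M = 0 by rewrite mxtrace0.
(* C has full column rank, so it cancels on the left; R has full row rank, so it cancels on the
   right. *)
apply: (row_full_inj (col_base_full M)); apply: (row_free_inj (row_base_free M)).
by rewrite mulmx0 mul0mx -[RHS]MM0 !mulmxA.
Qed.

Lemma lfun_trace_sqr0 (F : fieldType) (A : vectType F) (f : 'End(A)) :
  (forall x, f (f x) = 0) -> lfun_trace f = 0.
Proof.
move=> ff0; apply: mxtrace_sqr0.
rewrite -mxof_comp ?vbasisP //.
have ->: (f \o f)%VF = 0 by apply/lfunP=> x; rewrite comp_lfunE ff0 lfunE.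
by rewrite linear0.
Qed.

(** For fixed [z], the elements annihilating [z] from the left form the kernel of R_z, a subspace,
    so checking brackets suffices. *)
Lemma derived_lie_mul0 (F : fieldType) (A : vectType F)
    (mul : {bilinear A -> A -> A})
    (mulC : forall x y z : A, mul (mul x y) z = mul (mul y x) z) (d z : A) :
  d \in derived_lie mul -> mul d z = 0.
Proof.
move=> Dd; apply/eqP; rewrite -right_multE -memv_ker; apply: subvP Dd.
by apply/derived_lieP=> x y; rewrite memv_ker right_multE linearBl /= mulC subrr.
Qed.

Lemma mem_bracket (F : fieldType) (A : vectType F)
    (mul : {bilinear A -> A -> A}) (x y : A) :
  bracket mul x y \in derived_lie mul.
Proof. by move: x y; apply/derived_lieP. Qed.

Theorem theorem26 (F : fieldType) (charF0 : [pchar F] =i pred0)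
    (A : vectType F) (mul : {bilinear A -> A -> A})
    (lsA : left_symmetric mul)
    (mulC : forall x y z : A, mul (mul x y) z = mul (mul y x) z) :
  two_sided_ideal mul (koszul_radical mul) /\
  (derived_lie mul <= koszul_radical mul)%VS.
Proof.
have [idR _ maxR] := koszul_radicalP mul.
have D0 d z : d \in derived_lie mul -> mul d z = 0 by apply: derived_lie_mul0.
have sDR : (derived_lie mul <= koszul_radical mul)%VS.
  apply: maxR => [x d Dd | ].
    (* Subtracting d x = 0 turns x d into the bracket [x, d]. *)
    by rewrite -[mul x d]subr0 -(D0 d x Dd) mem_bracket.
  apply/subvP=> d Dd; rewrite mem_trace_kernel lfun_trace_sqr0 // => x.
  by rewrite !right_multE mulC (D0 d x Dd) linear0l.
split=> //; split=> // a x Ra.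
(* x a stays in the left ideal R(A), and [a, x] lies in [A, A]. *)
rewrite -[mul a x](subrK (mul x a)) memvD ?idR //.
by apply: (subvP sDR); apply: mem_bracket.
Qed.
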